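(* Let $A\in\mathbb{C}^{n\times n}$ and let $X$ be a minimal rank weak Drazin inverse of $A$. If $Y=A^{\dagger}AXAA^{\dagger}$, then $Y$ is a strong Bott–Duffin $(A^{\dagger}AXA,\;AXAA^{\dagger})$-inverse of $A$.
   Context: $A^{\dagger}$ is the Moore–Penrose inverse of $A$. The index $\operatorname{ind}(A)$ is the smallest nonnegative integer $k$ such that $\operatorname{rank}(A^k)=\operatorname{rank}(A^{k+1})$. $A^{D}$ is the Drazin inverse of $A$: the unique $T$ with $TAT=T$, $AT=TA$, $A^{k+1}T=A^k$ where $k=\operatorname{ind}(A)$. A matrix $X\in\mathbb{C}^{n\times n}$ is a minimal rank weak Drazin inverse of $A$ if $XA^{k+1}=A^{k}$ for some $k\in\mathbb{N}$ and $\operatorname{rank}(X)=\operatorname{rank}(A^{D})$. For a fixed such $X$, $A^{\dagger}AXAA^{\dagger}$ is called the weak CMP inverse of $A$. Given a semigroup $S$ and idempotents $e,f\in S$, an element $y\in S$ is the strong Bott–Duffin $(e,f)$-inverse of $a\in S$ if $yay=y$, $ya=e$ and $ay=f$ (such $y$ is unique if it exists). Here $S=\mathbb{C}^{n\times n}$ under multiplication; the assertion includes that the two given matrices $e,f$ are idempotent. *)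

(* Defs.v *)
From HB Require Import structures.
From mathcomp Require Import all_boot all_order all_algebra.
From mathcomp Require Export complex reals.
Export GRing.Theory Num.Theory.

Set Implicit Arguments.
Unset Strict Implicit.
Unset Printing Implicit Defensive.

Import Order.TTheory.
Local Open Scope ring_scope.
Local Open Scope sesquilinear_scope.

Section MoorePenrose.
Variable C : numClosedFieldType.

Definition is_moore_penrose m n (A : 'M[C]_(m, n)) (P : 'M[C]_(n, m)) : bool :=
  [&& A *m P *m A == A,
      P *m A *m P == P,
      (A *m P)^t* == A *m P &
      (P *m A)^t* == P *m A].

Lemma trmxCM m n p (A : 'M[C]_(m, n)) (B : 'M[C]_(n, p)) :
  (A *m B)^t* = B^t* *m A^t*.
Proof. by rewrite trmx_mul map_mxM. Qed.

Lemma mulmx_trmxC_eq0 m n (A : 'M[C]_(m, n)) : A *m A^t* = 0 -> A = 0.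
Proof.
move=> A0; apply/matrixP => i j; rewrite mxE; apply/eqP; rewrite -normr_eq0.
have /matrixP/(_ i i) := A0; rewrite !mxE => /eqP.
rewrite (eq_bigr (fun j => `|A i j| ^+ 2)); last first.
  by move=> l _; rewrite !mxE -normCK.
rewrite psumr_eq0 => [/allP/(_ j)|l _]; last by rewrite exprn_ge0.
by rewrite mem_index_enum sqrf_eq0; apply.
Qed.

Lemma gram_unitmx m n (A : 'M[C]_(m, n)) : row_free A -> A *m A^t* \in unitmx.
Proof.
move=> fA; rewrite -row_free_unit -kermx_eq0; apply/eqP.
apply: (row_free_inj fA); rewrite mul0mx; apply: mulmx_trmxC_eq0.
by rewrite trmxCM mulmxA -[kermx _ *m A *m _]mulmxA mulmx_ker mul0mx.
Qed.

(* With a full-rank factorization A = B D take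
   P = D^* (D D^* )^-1 (B^* B)^-1 B^*. *)
Lemma moore_penrose_exists m n (A : 'M[C]_(m, n)) :
  exists P, is_moore_penrose A P.
Proof.
pose B := col_base A; pose D := row_base A.
have AE : A = B *m D by rewrite /B /D mulmx_base.
have uD : D *m D^t* \in unitmx by apply/gram_unitmx/row_base_free.
have uB : B^t* *m B \in unitmx.
  rewrite -{2}[B]trmxCK; apply: gram_unitmx.
  by rewrite /row_free mxrank_map mxrank_tr; apply: col_base_full.
clearbody B D; move: (\rank A) B D AE uD uB => r B D AE uD uB.
pose G := D *m D^t*; pose H := B^t* *m B.
have hG : (invmx G)^t* = invmx G.
  by rewrite trmx_inv map_invmx trmxCM trmxCK.
have hH : (invmx H)^t* = invmx H.
  by rewrite trmx_inv map_invmx trmxCM trmxCK.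
exists (D^t* *m invmx G *m invmx H *m B^t*).
set P := (X in is_moore_penrose _ X).
have AP : A *m P = B *m invmx H *m B^t*.
  rewrite AE /P !mulmxA -(mulmxA B D) -(mulmxA B (D *m _)) -/G.
  by rewrite mulmxV // mulmx1.
have PA : P *m A = D^t* *m invmx G *m D.
  have -> : P *m A = D^t* *m invmx G *m (invmx H *m H) *m D.
    by rewrite AE /P /H !mulmxA.
  by rewrite mulVmx // mulmx1.
apply/and4P; split; apply/eqP.
- have -> : A *m P *m A = B *m (invmx H *m H) *m D.
    by rewrite AP AE /H !mulmxA.
  by rewrite mulVmx // mulmx1.
- have -> : P *m A *m P = D^t* *m (invmx G *m G) *m invmx G *m invmx H *m B^t*.
    by rewrite PA /P /G !mulmxA.
  by rewrite mulVmx // mulmx1.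
- by rewrite AP !trmxCM hH trmxCK mulmxA.
- by rewrite PA !trmxCM hG trmxCK mulmxA.
Qed.

Definition moore_penrose m n (A : 'M[C]_(m, n)) : 'M[C]_(n, m) :=
  xchoose (moore_penrose_exists A).

Lemma moore_penroseP m n (A : 'M[C]_(m, n)) :
  is_moore_penrose A (moore_penrose A).
Proof. exact: xchooseP. Qed.

Lemma moore_penrose_uniq m n (A : 'M[C]_(m, n)) P :
  is_moore_penrose A P -> P = moore_penrose A.
Proof.
have := moore_penroseP A; set Q := moore_penrose A.
move=> /and4P[/eqP q1 /eqP q2 /eqP q3 /eqP q4].
move=> /and4P[/eqP p1 /eqP p2 /eqP p3 /eqP p4].
have AP : A *m P = A *m Q.
  rewrite -{1}q1 -[_ *m A *m P]mulmxA -p3 -{1}q3 -trmxCM.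
  by rewrite mulmxA p1 q3.
have PA : P *m A = Q *m A.
  rewrite -{1}q1 !mulmxA -[_ *m Q *m A]mulmxA -p4 -{1}q4 -trmxCM.
  by rewrite -mulmxA (mulmxA A) p1 q4.
by rewrite -p2 PA -mulmxA AP mulmxA q2.
Qed.

End MoorePenrose.

Section Drazin.
Variables (F : fieldType) (n : nat).
Implicit Types A T X : 'M[F]_n.

Lemma mxindex_exists A : exists k, \rank (A ^+ k) == \rank (A ^+ k.+1).
Proof.
have le k : (\rank (A ^+ k.+1) <= \rank (A ^+ k))%N.
  by rewrite exprS mxrankM_maxr.
case: (boolP [exists k : 'I_n.+1, \rank (A ^+ k) == \rank (A ^+ k.+1)]).
  by case/existsP=> k Hk; exists k.
move=> /existsPn H.
have bound k : (k <= n.+1)%N -> (\rank (A ^+ k) + k <= n)%N.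
  elim: k => [|k IH] ltk; first by rewrite addn0 rank_leq_row.
  have := H (Ordinal ltk); have := le k; rewrite /= eq_sym => l1 l2.
  apply: leq_trans (IH (ltnW ltk)); rewrite addnS -addSn leq_add2r.
  by rewrite ltn_neqAle l2.
have := bound _ (leqnn _); rewrite addnS.
by move=> /(leq_ltn_trans (leq_addl _ _)); rewrite ltnn.
Qed.

Definition mxindex A : nat := ex_minn (mxindex_exists A).

Definition is_drazin A T : bool :=
  [&& T *m A *m T == T,
      A *m T == T *m A &
      A ^+ (mxindex A).+1 *m T == A ^+ mxindex A].

Lemma rank_mxindexD A j : \rank (A ^+ (mxindex A + j)) = \rank (A ^+ mxindex A).
Proof.
rewrite /mxindex; case: ex_minnP => k /eqP rk _.
have subS : (A ^+ k <= A ^+ k.+1)%MS.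
  have s : (A ^+ k.+1 <= A ^+ k)%MS by rewrite exprS -mulmxE submxMl.
  by have [_ <-] := mxrank_leqif_sup s; rewrite rk.
suff sub : (A ^+ k <= A ^+ (k + j))%MS.
  apply/eqP; rewrite eqn_leq [X in _ && X](mxrankS sub) andbT.
  by rewrite addnC exprD -mulmxE mxrankM_maxr.
elim: j => [|j IH]; first by rewrite addn0.
apply: submx_trans subS _; rewrite addnS !exprSr -!mulmxE; exact: submxMr.
Qed.

(* With k the index, T = A^k G A^k for any inner inverse G of A^(2k+1). *)
Lemma drazin_exists A : exists T, is_drazin A T.
Proof.
pose k := mxindex A; pose M := A ^+ (k + k.+1).
have rM : \rank M = \rank (A ^+ k) by exact: rank_mxindexD.
have [Z ZE] : exists Z, A ^+ k = Z *m M.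
  apply/submxP.
  have s : (M <= A ^+ k)%MS by rewrite /M addnC exprD -mulmxE submxMl.
  by have [_ <-] := mxrank_leqif_sup s; rewrite rM.
have [W WE] : exists W, A ^+ k = M *m W.
  suff /submxP[V VE] : ((A ^+ k)^T <= M^T)%MS.
    by exists V^T; rewrite -[A ^+ k]trmxK VE trmx_mul trmxK.
  have s : (M^T <= (A ^+ k)^T)%MS by rewrite /M exprD -mulmxE trmx_mul submxMl.
  by have [_ <-] := mxrank_leqif_sup s; rewrite !mxrank_tr rM.
rewrite !mulmxE in ZE WE.
have Mk1 : M = A ^+ k * A ^+ k.+1 by rewrite -exprD.
have Mk2 : M = A ^+ k.+1 * A ^+ k by rewrite -exprD addnC.
have com : A * M = M * A by rewrite -exprS -exprSr.
pose T := A ^+ k * W.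
have TZ : T = Z * A ^+ k by rewrite /T {1}ZE -mulrA -WE.
have TA : T * A = A ^+ k.+1 * W.
  have -> : T * A = Z * (M * A) * W.
    by rewrite -com TZ -!mulrA -WE -exprSr -exprS.
  by rewrite mulrA -ZE -exprSr.
have AT : A * T = A ^+ k.+1 * W by rewrite /T mulrA -exprS.
exists T; apply/and3P; rewrite -/k !mulmxE; split; apply/eqP.
- have -> : T * A * T = Z * (A ^+ k.+1 * A ^+ k) * W.
    by rewrite {1}TZ /T exprSr !mulrA.
  by rewrite -Mk2 -mulrA -WE -TZ.
- by rewrite AT TA.
- by rewrite /T mulrA -Mk2 -WE.
Qed.

Definition drazin A : 'M[F]_n := xchoose (drazin_exists A).

Lemma drazinP A : is_drazin A (drazin A).
Proof. exact: xchooseP. Qed.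

Lemma drazin_uniq A T : is_drazin A T -> T = drazin A.
Proof.
have := drazinP A; set S := drazin A; set k := mxindex A.
rewrite /is_drazin -/k !mulmxE.
move=> /and3P[/eqP s1 /eqP s2 /eqP s3] /and3P[/eqP t1 /eqP t2 /eqP t3].
have iter U : U * A * U = U -> A * U = U * A ->
    (forall j, U = A ^+ j * U ^+ j.+1) /\ (forall j, U = U ^+ j.+1 * A ^+ j).
  move=> u1 u2; have c j : A ^+ j * U ^+ j.+1 = U ^+ j.+1 * A ^+ j.
    by apply: commrX; apply/commr_sym/commrX.
  suff H j : U = A ^+ j * U ^+ j.+1 by split=> // j; rewrite -c.
  elim: j => [|j IH]; first by rewrite mul1r.
  have E : U ^+ j.+1 = A * U ^+ j.+2.
    by rewrite exprS -{1}u1 -u2 -!mulrA -!exprS.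
  by rewrite {1}IH E mulrA -exprSr.
have [Tl Tr] := iter T t1 t2; have [Sl Sr] := iter S s1 s2.
have sk : S * A ^+ k.+1 = A ^+ k.
  by rewrite -s3; apply/commr_sym/commr_sym/commrX; rewrite /GRing.comm s2.
have E1 : T = S * A * T.
  have -> : S * A * T = S * A ^+ k.+1 * T ^+ k.+1.
    by rewrite {1}(Tl k) [A ^+ k.+1]exprS !mulrA.
  by rewrite sk -Tl.
have E2 : S = S * A * T.
  have -> : S * A * T = S ^+ k.+1 * (A ^+ k.+1 * T).
    by rewrite {1}(Sr k) exprSr [A ^+ k.+1]exprSr !mulrA.
  by rewrite t3 -Sr.
by rewrite E1 -E2.
Qed.

Definition minrank_weak_drazin A X : Prop :=
  (exists k : nat, X *m A ^+ k.+1 = A ^+ k) /\ \rank X = \rank (drazin A).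

End Drazin.

Definition strong_bott_duffin (S : Type) (mul : SemiGroup.law S)
    (e f a y : S) : Prop :=
  [/\ mul e e = e, mul f f = f, mul (mul y a) y = y, mul y a = e &
      mul a y = f].

HB.instance Definition _ (R : pzSemiRingType) (n : nat) :=
  SemiGroup.isLaw.Build 'M[R]_n (@mulmx R n n n) (@mulmxA R n n n n).

(* Main.v *)
Require Import Defs.
From mathcomp Require Import all_boot all_order all_algebra complex reals.

(** From X A^(k+1) = A^k and rank X = rank A^D <= rank A^k, the matrices X and
    A^k have the same column space, so X = A^k Z for some Z. Hence
    X A X = X A^(k+1) Z = A^k Z = X, and the identities for Y follow from
    A P A = A, where P is the Moore-Penrose inverse of A. *)

Local Open Scope ring_scope.

(** With [D = drazin A], commutation turns [D A D = D] into [D = A D^2], which is then iterated. *)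
Lemma drazin_expE (F : fieldType) (n : nat) (A : 'M[F]_n) (k : nat) :
  drazin A = A ^+ k *m drazin A ^+ k.+1.
Proof.
have /and3P[/eqP DAD /eqP AD _] := drazinP A.
rewrite !mulmxE in DAD AD *; elim: k => [|k IH]; first by rewrite mul1r.
have DE : drazin A ^+ k.+1 = A * drazin A ^+ k.+2.
  by rewrite exprS -{1}DAD -AD -!mulrA -!exprS.
by rewrite {1}IH DE mulrA -exprSr.
Qed.

(** Applied to the exponent [k] of a weak Drazin inverse, which may differ from the index. *)
Lemma rank_drazin_le (F : fieldType) (n : nat) (A : 'M[F]_n) (k : nat) :
  (\rank (drazin A) <= \rank (A ^+ k))%N.
Proof. by rewrite (drazin_expE _ _ A k) mxrankM_maxl. Qed.

Lemma minrank_weak_drazin_outer (F : fieldType) (n : nat) (A X : 'M[F]_n) :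
  minrank_weak_drazin A X -> X *m A *m X = X.
Proof.
move=> [[k XA] rX].
(* Transposes appear because [submx] compares row spaces, while column spaces are meant. *)
have sub : ((A ^+ k)^T <= X^T)%MS by rewrite -XA trmx_mul submxMl.
have /submxP[Z XZ] : (X^T <= (A ^+ k)^T)%MS.
  have [_ <-] := mxrank_leqif_sup sub.
  by rewrite eqn_leq mxrankS //= !mxrank_tr rX rank_drazin_le.
have XE : X = A ^+ k *m Z^T by rewrite -[X]trmxK XZ trmx_mul trmxK.
have AS : A *m A ^+ k = A ^+ k.+1 by rewrite mulmxE -exprS.
by rewrite {2}XE mulmxA -(mulmxA X) AS XA -XE.
Qed.

Theorem proposition3p13 (R : realType) (n : nat) (A X Y : 'M[R[i]]_n)
    (hX : minrank_weak_drazin A X)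
    (hY : Y = moore_penrose A *m A *m X *m A *m moore_penrose A) :
  strong_bott_duffin (@mulmx R[i] n n n)
    (moore_penrose A *m A *m X *m A)
    (A *m X *m A *m moore_penrose A)
    A Y.
Proof.
have XAX := minrank_weak_drazin_outer _ _ _ _ hX.
have /and4P[/eqP APA _ _ _] := moore_penroseP A.
move: (moore_penrose A) APA hY => P APA ->.
(* The left factor [U] lets these identities rewrite inside left-associated products. *)
have APAl (U : 'M_n) : U *m A *m P *m A = U *m A.
  by rewrite -!mulmxA (mulmxA A) APA.
have XAXl (U : 'M_n) : U *m X *m A *m X = U *m X.
  by rewrite -!mulmxA (mulmxA X) XAX.
by split; rewrite /= ?mulmxA ?(APAl, XAXl, APA).
Qed.
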